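(* Let $\mathcal{M}_1$ be a fundamental model in $\Delta_{n_1}$ of degree $d_1$, represented by $h_1$, with $h_1(d_1,0)=1$, and let $\mathcal{M}_2$ be any fundamental model in $\Delta_{n_2}$ of degree $d_2$. Then the composition of $\mathcal{M}_1$ and $\mathcal{M}_2$ at $(d_1,0)$ with $\eta=1$ is a fundamental model in $\Delta_{n_1+n_2}$ of degree $d_1+d_2$.
   Context: A reduced model in the probability simplex $\Delta_n=\{p\in\mathbb{R}^{n+1}\mid \sum_i p_i=1,\ p_i\ge 0\}$ is given by a collection of $n+1$ triples $(c_i,\nu_i,\mu_i)_{i=0}^n$ with $c_i\in\mathbb{R}_{>0}$ and $\nu_i,\mu_i\in\mathbb{N}=\{0,1,2,\ldots\}$ such that the pairs $(\nu_i,\mu_i)$ are pairwise distinct and all different from $(0,0)$, and $\sum_{i=0}^n c_i t^{\nu_i}(1-t)^{\mu_i}=1$ for all $t\in[0,1]$. Its degree is $\max_i(\nu_i+\mu_i)$. It is fundamental if, given the exponent pairs $(\nu_i,\mu_i)$, the scalings $c_i$ are uniquely determined by the constraint $\sum_{i=0}^n c_i t^{\nu_i}(1-t)^{\mu_i}=1$ (as a polynomial identity in $t$). The model is represented by the function $h:\mathbb{Z}^2\to\mathbb{R}_{\ge0}$ with $h(\nu_i,\mu_i)=c_i$ and $h=0$ elsewhere; its support is $\operatorname{supp}(h)$, which has $n+1$ elements for a model in $\Delta_n$. For reduced models $\mathcal{M}_1,\mathcal{M}_2$ represented by $h_1,h_2$, a point $(a,b)\in\operatorname{supp}(h_1)$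 and $0<\eta\le h_1(a,b)$, the composition of $\mathcal{M}_1$ and $\mathcal{M}_2$ at $(a,b)$ with parameter $\eta$ is the reduced model represented by $$h_{\mathrm{comp}}^{\eta}(\nu,\mu)=\begin{cases} h_1(\nu,\mu), & \text{if } \nu<a \text{ or } \mu<b,\\ h_1(\nu,\mu)-\eta, & \text{if } (\nu,\mu)=(a,b),\\ h_1(\nu,\mu)+\eta\, h_2(\nu-a,\mu-b), & \text{otherwise.}\end{cases}$$ *)

(* Defs.v *)
From HB Require Import structures.
From mathcomp Require Import all_boot all_order all_algebra.
From mathcomp Require Import reals.

Set Implicit Arguments.
Unset Strict Implicit.
Unset Printing Implicit Defensive.

Import Order.TTheory GRing.Theory Num.Theory.
Local Open Scope ring_scope.

(* [reduced_model R n] is the type of reduced models in the simplex Delta_n;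
   the n + 1 triples are listed in some order. *)
Record reduced_model (R : realType) (n : nat) := ReducedModel {
  scaling : 'I_n.+1 -> R;
  nu : 'I_n.+1 -> nat;
  mu : 'I_n.+1 -> nat;
  scaling_gt0 : forall i, 0 < scaling i;
  exponents_inj : injective (fun i => (nu i, mu i));
  exponents_neq0 : forall i, (nu i, mu i) <> (0%N, 0%N);
  sum_eq1 : forall t : R, 0 <= t <= 1 ->
    \sum_(i < n.+1) scaling i * t ^+ nu i * (1 - t) ^+ mu i = 1
}.

Definition degree (R : realType) (n : nat) (M : reduced_model R n) : nat :=
  \max_(i < n.+1) (nu M i + mu M i)%N.

(* The competing scalings range over all real numbers. Requiring them to be
   positive would give the same notion: if c' is any other real solution, then
   c + e (c' - c) is another positive solution for small e > 0. *)
Definition fundamental (R : realType) (n : nat) (M : reduced_model R n) : Prop :=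
  forall c' : 'I_n.+1 -> R,
    \sum_(i < n.+1) c' i *: ('X ^+ nu M i * (1 - 'X) ^+ mu M i) = 1 :> {poly R} ->
    c' =1 scaling M.

Definition represents (R : realType) (n : nat)
    (h : int * int -> R) (M : reduced_model R n) : Prop :=
  (forall i, h ((nu M i)%:Z, (mu M i)%:Z) = scaling M i) /\
  (forall p : int * int,
     (forall i, ((nu M i)%:Z, (mu M i)%:Z) <> p) -> h p = 0).

Definition comp_fun (R : realType) (h1 h2 : int * int -> R) (ab : int * int)
    (eta : R) (p : int * int) : R :=
  if (p.1 < ab.1) || (p.2 < ab.2) then h1 p
  else if p == ab then h1 p - eta
  else h1 p + eta * h2 (p.1 - ab.1, p.2 - ab.2).

(* [M] is the composition at [ab] with parameter [eta] of the models
   represented by [h1] and [h2]; as [M] is determined by the function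
   representing it only up to the order of its triples, this is a relation. *)
Definition is_composition (R : realType) (n : nat) (h1 h2 : int * int -> R)
    (ab : int * int) (eta : R) (M : reduced_model R n) : Prop :=
  [/\ h1 ab != 0, 0 < eta <= h1 ab & represents (comp_fun h1 h2 ab eta) M].

(* Main.v *)
Require Import Defs.
From mathcomp Require Import all_boot all_order all_algebra.
From mathcomp Require Import reals.

Set Implicit Arguments.
Unset Strict Implicit.
Unset Printing Implicit Defensive.

Import Order.TTheory GRing.Theory Num.Theory.
Local Open Scope ring_scope.

(** Since [(d1, 0)] is the only exponent pair of [M1] with [nu >= d1], the
    composition replaces the monomial [t^d1] of [M1] by [t^d1] times the monomials
    of [M2]. Competing scalings for it give an identity [P + t^d1 Q = 1], with [P]
    supported on the remaining exponents of [M1] and hence of degree at most [d1].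
    So [Q] is a constant [q]; as [P + q t^d1 = 1], fundamentality of [M1] fixes [P]
    and [q = 1], and then fundamentality of [M2] fixes the scalings in [Q = 1]. *)

(** In the composition the left summand indexes the triples of [M1] other than the replaced one, the
    right summand all triples of [M2]. The cast bridges [(n1 + n2).+1] and [n1 + n2.+1], which are
    not convertible. *)
Definition split_addS (n1 n2 : nat) (k : 'I_(n1 + n2).+1) : 'I_n1 + 'I_n2.+1 :=
  split (cast_ord (esym (addnS n1 n2)) k).

Definition unsplit_addS (n1 n2 : nat) (s : 'I_n1 + 'I_n2.+1) : 'I_(n1 + n2).+1 :=
  cast_ord (addnS n1 n2) (unsplit s).

Lemma split_addSK (n1 n2 : nat) :
  cancel (@split_addS n1 n2) (@unsplit_addS n1 n2).
Proof. by move=> k; rewrite /unsplit_addS splitK cast_ordKV. Qed.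

Lemma unsplit_addSK (n1 n2 : nat) :
  cancel (@unsplit_addS n1 n2) (@split_addS n1 n2).
Proof. by move=> s; rewrite /split_addS cast_ordK unsplitK. Qed.

Lemma big_split_addS (T : Type) (idx : T) (op : Monoid.com_law idx)
    (n1 n2 : nat) (F : 'I_n1 + 'I_n2.+1 -> T) :
  \big[op/idx]_(k < (n1 + n2).+1) F (split_addS k) =
  op (\big[op/idx]_(i < n1) F (inl i)) (\big[op/idx]_(j < n2.+1) F (inr j)).
Proof.
rewrite (reindex (@unsplit_addS n1 n2)) /=.
  by rewrite (eq_bigr F) ?big_sumType // => s _; rewrite unsplit_addSK.
by exists (@split_addS n1 n2) => k _; rewrite (split_addSK, unsplit_addSK).
Qed.

Lemma leq_degree (R : realType) (n : nat) (M : reduced_model R n) (i : 'I_n.+1) :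
  (nu M i + mu M i <= degree M)%N.
Proof. exact: leq_bigmax. Qed.

Lemma represents_neq0 (R : realType) (n : nat) (M : reduced_model R n)
    (h : int * int -> R) (p : int * int) :
  represents h M -> h p != 0 -> exists i, ((nu M i)%:Z, (mu M i)%:Z) = p.
Proof.
case=> _ h0 hp.
have [/existsP[i /eqP <-]|/existsPn np] :=
  boolP [exists i, ((nu M i)%:Z, (mu M i)%:Z) == p]; first by exists i.
by case/eqP: hp; apply: h0 => i; apply/eqP.
Qed.

Lemma size_monomial_X_1subX (R : nzRingType) (a b : nat) :
  (size ('X ^+ a * (1 - 'X) ^+ b : {poly R})%R <= (a + b).+1)%N.
Proof.
have s2 : size (1 - 'X : {poly R}) = 2%N by rewrite -opprB size_polyN size_XsubC.
apply: leq_trans (size_polyMleq _ _) _; rewrite size_polyXn addSn /= -addnS leq_add2l.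
by apply: leq_trans (size_poly_exp_leq _ _) _; rewrite s2 mul1n.
Qed.

(** Multiplying a nonzero [q] by ['X^d] raises its size by exactly [d], which leaves [q] size at
    most 1; the zero polynomial needs its own case. *)
Lemma size_mulXn_const (R : comNzRingType) (d : nat) (q : {poly R}) :
  (size ('X^d * q)%R <= d.+1)%N -> q = (q`_0)%:P.
Proof.
have [->|q0] := eqVneq q 0; first by rewrite coef0.
by rewrite mulrC size_mulXn // -addn1 leq_add2l; apply: size1_polyC.
Qed.

(** Here and below [i0] is meant to be the index in [M1] of the pair [(degree M1, 0)], so [lift i0]
    enumerates the triples that survive. *)
Definition comp_scaling (R : realType) (n1 n2 : nat) (M1 : reduced_model R n1)
    (M2 : reduced_model R n2) (i0 : 'I_n1.+1) (s : 'I_n1 + 'I_n2.+1) : R :=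
  match s with inl i => scaling M1 (lift i0 i) | inr j => scaling M2 j end.

Definition comp_nu (R : realType) (n1 n2 : nat) (M1 : reduced_model R n1)
    (M2 : reduced_model R n2) (i0 : 'I_n1.+1) (s : 'I_n1 + 'I_n2.+1) : nat :=
  match s with inl i => nu M1 (lift i0 i) | inr j => (degree M1 + nu M2 j)%N end.

Definition comp_mu (R : realType) (n1 n2 : nat) (M1 : reduced_model R n1)
    (M2 : reduced_model R n2) (i0 : 'I_n1.+1) (s : 'I_n1 + 'I_n2.+1) : nat :=
  match s with inl i => mu M1 (lift i0 i) | inr j => mu M2 j end.

(** If [nu] reached the degree, then [mu] would be 0 and the pair would coincide with that of [i0].
    This strict bound separates the exponents kept from [M1] from the shifted ones of [M2]. *)
Lemma nu_lift_lt (R : realType) (n : nat) (M : reduced_model R n)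
    (i0 : 'I_n.+1) (i : 'I_n) :
  nu M i0 = degree M -> mu M i0 = 0%N -> (nu M (lift i0 i) < degree M)%N.
Proof.
move=> nu0 mu0; have led := leq_degree M (lift i0 i).
rewrite ltn_neqAle (leq_trans (leq_addr _ _) led) andbT; apply/eqP => e.
have m0 : mu M (lift i0 i) = 0%N.
  by move: led; rewrite e -[leqRHS]addn0 leq_add2l leqn0 => /eqP.
have /eqP : i0 = lift i0 i by apply: (exponents_inj (r := M)); rewrite nu0 mu0 e m0.
by rewrite (negbTE (neq_lift _ _)).
Qed.

Lemma comp_exponents_inj (R : realType) (n1 n2 : nat) (M1 : reduced_model R n1)
    (M2 : reduced_model R n2) (i0 : 'I_n1.+1) :
  nu M1 i0 = degree M1 -> mu M1 i0 = 0%N ->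
  injective (fun s => (comp_nu M1 M2 i0 s, comp_mu M1 M2 i0 s)).
Proof.
move=> nu0 mu0 [i|j] [i'|j'] /= [].
- move=> e1 e2; congr inl; apply: (@lift_inj _ i0).
  by apply: (exponents_inj (r := M1)); rewrite e1 e2.
- move=> e1; have := nu_lift_lt i nu0 mu0.
  by rewrite e1 ltnNge leq_addr.
- move=> e1; have := nu_lift_lt i' nu0 mu0.
  by rewrite -e1 ltnNge leq_addr.
- move=> /addnI e1 e2; congr inr.
  by apply: (exponents_inj (r := M2)); rewrite e1 e2.
Qed.

Lemma comp_exponents_neq0 (R : realType) (n1 n2 : nat) (M1 : reduced_model R n1)
    (M2 : reduced_model R n2) (i0 : 'I_n1.+1) (s : 'I_n1 + 'I_n2.+1) :
  (comp_nu M1 M2 i0 s, comp_mu M1 M2 i0 s) <> (0%N, 0%N).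
Proof.
case: s => [i|j] /=; first exact: exponents_neq0.
case=> /eqP; rewrite addn_eq0 => /andP[_ /eqP e1] e2.
by case: (@exponents_neq0 _ _ M2 j); rewrite e1 e2.
Qed.

(** The term of [i0] in the identity of [M1] is [t ^+ degree M1]; multiplying it by the sum of [M2],
    which equals 1, changes nothing. *)
Lemma comp_sum_eq1 (R : realType) (n1 n2 : nat) (M1 : reduced_model R n1)
    (M2 : reduced_model R n2) (i0 : 'I_n1.+1) (t : R) :
  nu M1 i0 = degree M1 -> mu M1 i0 = 0%N -> scaling M1 i0 = 1 -> 0 <= t <= 1 ->
  \sum_(k < (n1 + n2).+1) comp_scaling M1 M2 i0 (split_addS k)
    * t ^+ comp_nu M1 M2 i0 (split_addS k)
    * (1 - t) ^+ comp_mu M1 M2 i0 (split_addS k) = 1.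
Proof.
move=> nu0 mu0 c0 t01.
rewrite (big_split_addS _ (fun s => comp_scaling M1 M2 i0 s
    * t ^+ comp_nu M1 M2 i0 s * (1 - t) ^+ comp_mu M1 M2 i0 s)) /=.
rewrite -[RHS](sum_eq1 M1 t01) (bigD1_ord i0) //= nu0 mu0 c0 mul1r mulr1 addrC.
congr (_ + _); rewrite -[RHS]mulr1 -[in RHS](sum_eq1 M2 t01) mulr_sumr.
by apply: eq_bigr => j _; rewrite exprD !mulrA (mulrC (scaling M2 j)).
Qed.

Definition comp_model (R : realType) (n1 n2 : nat) (M1 : reduced_model R n1)
    (M2 : reduced_model R n2) (i0 : 'I_n1.+1) (nu0 : nu M1 i0 = degree M1)
    (mu0 : mu M1 i0 = 0%N) (c0 : scaling M1 i0 = 1) : reduced_model R (n1 + n2).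
Proof.
apply: (@ReducedModel R (n1 + n2)
  (fun k => comp_scaling M1 M2 i0 (split_addS k))
  (fun k => comp_nu M1 M2 i0 (split_addS k))
  (fun k => comp_mu M1 M2 i0 (split_addS k))).
- by move=> k; case: split_addS => [i|j]; apply: scaling_gt0.
- exact: inj_comp (comp_exponents_inj nu0 mu0) (can_inj (@split_addSK _ _)).
- by move=> k; apply: comp_exponents_neq0.
- by move=> t; apply: comp_sum_eq1.
Defined.

(** The shift adds [degree M1] to every total degree in [M2], so a pair of maximal total degree in
    [M2] attains the bound. *)
Lemma degree_comp_model (R : realType) (n1 n2 : nat) (M1 : reduced_model R n1)
    (M2 : reduced_model R n2) (i0 : 'I_n1.+1) (nu0 : nu M1 i0 = degree M1)
    (mu0 : mu M1 i0 = 0%N) (c0 : scaling M1 i0 = 1) :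
  degree (comp_model M2 nu0 mu0 c0) = (degree M1 + degree M2)%N.
Proof.
apply/eqP; rewrite eqn_leq; apply/andP; split.
  apply/bigmax_leqP => k _ /=; case: split_addS => [i|j] /=.
    exact: leq_trans (leq_degree M1 _) (leq_addr _ _).
  by rewrite -addnA leq_add2l leq_degree.
have [|j] := @bigop.eq_bigmax _ (fun j => nu M2 j + mu M2 j)%N; first by rewrite card_ord.
rewrite -/(degree M2) => ->.
have := leq_degree (comp_model M2 nu0 mu0 c0) (unsplit_addS (inr j)).
by rewrite /= unsplit_addSK /= addnA.
Qed.

Lemma fundamental_comp_model (R : realType) (n1 n2 : nat)
    (M1 : reduced_model R n1) (M2 : reduced_model R n2) (i0 : 'I_n1.+1)
    (nu0 : nu M1 i0 = degree M1) (mu0 : mu M1 i0 = 0%N) (c0 : scaling M1 i0 = 1) :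
  fundamental M1 -> fundamental M2 ->
  fundamental (comp_model M2 nu0 mu0 c0).
Proof.
move=> M1f M2f c' /=.
pose g s := c' (unsplit_addS s).
pose q := \sum_(j < n2.+1) g (inr j) *: ('X ^+ nu M2 j * (1 - 'X) ^+ mu M2 j).
pose p := \sum_(i < n1) g (inl i) *:
  ('X ^+ nu M1 (lift i0 i) * (1 - 'X) ^+ mu M1 (lift i0 i)).
under eq_bigr => k _ do rewrite -{1}(split_addSK k) -/(g _).
rewrite (big_split_addS _ (fun s => g s *:
  ('X ^+ comp_nu M1 M2 i0 s * (1 - 'X) ^+ comp_mu M1 M2 i0 s))) /=.
have -> : \sum_(j < n2.+1) g (inr j) *:
    ('X ^+ (degree M1 + nu M2 j) * (1 - 'X) ^+ mu M2 j) = 'X^(degree M1) * q.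
  by rewrite mulr_sumr; apply: eq_bigr => j _; rewrite exprD -mulrA scalerAr.
rewrite -/p => pq1.
have size_p : (size p <= (degree M1).+1)%N.
  apply: (leq_trans (size_sum _ _ _)); apply/bigmax_leqP => i _.
  apply: leq_trans (size_scale_leq _ _) _.
  apply: leq_trans (size_monomial_X_1subX _ _ _) _.
  by rewrite ltnS leq_degree.
have qC : q = (q`_0)%:P.
  apply: (@size_mulXn_const _ (degree M1)).
  (* Rewritten as [1 - p], the product inherits the size bound of [p]. *)
  have -> : 'X^(degree M1) * q = 1 - p by rewrite -pq1 [p + _]addrC addrK.
  apply: leq_trans (size_polyD _ _) _.
  by rewrite size_polyN geq_max size_p size_poly1.
(* With [q] constant, [pq1] is the identity of [M1] with these competing scalings: the constant sits
   at [i0]. *)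
pose c1 i := if unlift i0 i is Some i' then g (inl i') else q`_0.
have c1E : c1 =1 scaling M1.
  apply: M1f; rewrite (bigD1_ord i0) //= /c1 unlift_none nu0 mu0 expr0 mulr1.
  rewrite -[RHS]pq1 [in RHS]qC [RHS]addrC [_ * _%:P]mulrC mul_polyC; congr (_ + _).
  by apply: eq_bigr => i _; rewrite liftK.
have q0 : q`_0 = 1 by rewrite -c0 -c1E /c1 unlift_none.
have q1 : q = 1 by rewrite qC q0.
move=> k; rewrite -[k]split_addSK unsplit_addSK -/(g _).
case: (split_addS k) => [i|j] /=; first by rewrite -c1E /c1 liftK.
(* Unfolded, [q1] is the constraint that determines the scalings of [M2]. *)
exact: (M2f (fun j => g (inr j)) q1).
Qed.

Lemma represents_comp_model (R : realType) (n1 n2 : nat)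
    (M1 : reduced_model R n1) (M2 : reduced_model R n2) (h1 h2 : int * int -> R)
    (i0 : 'I_n1.+1) (nu0 : nu M1 i0 = degree M1) (mu0 : mu M1 i0 = 0%N)
    (c0 : scaling M1 i0 = 1) :
  represents h1 M1 -> represents h2 M2 ->
  represents (comp_fun h1 h2 ((degree M1)%:Z, 0) 1)
    (comp_model M2 nu0 mu0 c0).
Proof.
move=> r1 r2.
(* By [nu_lift_lt], only [i0] gives a support point this far right; hence the last branch of
   [comp_fun] reduces to the shifted [h2]. *)
have h1_right (a b : int) : (degree M1)%:Z <= a -> (a, b) != ((degree M1)%:Z, 0) ->
    h1 (a, b) = 0.
  move=> lea; apply: contraNeq => /(represents_neq0 r1)[i [ea eb]].
  case: (unliftP i0 i) ea eb => [i'|] -> ea eb.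
    by move: lea; rewrite -ea lez_nat leqNgt nu_lift_lt.
  by rewrite -ea -eb nu0 mu0.
split=> [k|[a b] ab] /=.
  rewrite /comp_fun /=; case: (split_addS k) => [i|j] /=.
    by rewrite ltz_nat nu_lift_lt //= r1.1.
  rewrite !ltz_nat ltnNge leq_addr ltn0 /=.
  (* Since [(0, 0)] is not an exponent pair of [M2], no shifted pair lands on the point where [eta]
     is subtracted. *)
  have neq : ((degree M1 + nu M2 j)%N%:Z, (mu M2 j)%:Z) != ((degree M1)%:Z, 0).
    apply/eqP => -[/eqP]; rewrite -[X in _ == X]addn0 eqn_add2l => /eqP e1 e2.
    by case: (@exponents_neq0 _ _ M2 j); rewrite e1 e2.
  rewrite (negbTE neq) h1_right ?lez_nat ?leq_addr // add0r mul1r subr0.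
  by rewrite PoszD addrC addKr r2.1.
rewrite /comp_fun /=; case: ifPn => [lt_ab|].
  (* A support point of [h1] in this region either survives in the composition, against [ab], or
     comes from [i0], which lies outside the region. *)
  apply/eqP; apply/negPn/negP => /(represents_neq0 r1)[i [ea eb]].
  case: (unliftP i0 i) ea eb => [i'|] -> ea eb.
    by apply: (ab (unsplit_addS (inl i'))); rewrite /= unsplit_addSK /= ea eb.
  by move: lt_ab; rewrite -ea -eb nu0 mu0 !ltxx.
rewrite negb_or -!leNgt => /andP[lea leb].
case: ifPn => [/eqP ->|neq].
  (* Since [eta] is the full value 1 of [h1] here, the point leaves the support. *)
  by have := r1.1 i0; rewrite nu0 mu0 c0 => ->; rewrite subrr.
rewrite h1_right // add0r mul1r.
apply/eqP; apply/negPn/negP => /(represents_neq0 r2)[j [ea eb]].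
apply: (ab (unsplit_addS (inr j))); rewrite /= unsplit_addSK /= PoszD ea eb.
by rewrite subr0 addrC subrK.
Qed.

Theorem theorem4p4 (R : realType) (n1 n2 d1 d2 : nat)
    (M1 : reduced_model R n1) (M2 : reduced_model R n2)
    (h1 h2 : int * int -> R)
    (h1_repr : represents h1 M1) (h2_repr : represents h2 M2)
    (M1_fund : fundamental M1) (M1_deg : degree M1 = d1)
    (h1_d1 : h1 (d1%:Z, 0) = 1)
    (M2_fund : fundamental M2) (M2_deg : degree M2 = d2) :
  exists M : reduced_model R (n1 + n2),
    [/\ is_composition h1 h2 (d1%:Z, 0) 1 M,
        fundamental M &
        degree M = (d1 + d2)%N].
Proof.
subst d1 d2.
have h1_neq0 : h1 ((degree M1)%:Z, 0) != 0 by rewrite h1_d1 oner_neq0.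
have [i0 [nu0 mu0]] := represents_neq0 h1_repr h1_neq0.
have c0 : scaling M1 i0 = 1 by rewrite -h1_repr.1 nu0 mu0.
exists (comp_model M2 nu0 mu0 c0); split.
- split=> //; first by rewrite h1_d1 ltr01 lexx.
  exact: represents_comp_model.
- exact: fundamental_comp_model.
- exact: degree_comp_model.
Qed.
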